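(* Let $\mathbb{F}$ be a division ring, $n$ a positive integer, $\sigma:\mathbb{F}\to\mathbb{F}^{n\times n}$ a ring morphism and $\delta:\mathbb{F}\to\mathbb{F}^n$ a $\sigma$-derivation. Let $\mathbf{a}_1,\dots,\mathbf{a}_\ell\in\mathbb{F}^n$ and let $\mathcal{B}_i^{\mathcal{D}}=\{\beta_1^{(i)},\dots,\beta_{M_i}^{(i)}\}\subseteq\mathbb{F}^*$ for $i=1,\dots,\ell$. Write $\mathbf{a}=(\mathbf{a}_1,\dots,\mathbf{a}_\ell)$, $\mathcal{B}^{\mathcal{D}}=(\mathcal{B}_1^{\mathcal{D}},\dots,\mathcal{B}_\ell^{\mathcal{D}})$ and $M=M_1+\cdots+M_\ell$. Define $\mathcal{B}=\{\mathbf{b}_1,\mathbf{b}_2,\dots,\mathbf{b}_M\}\subseteq\mathbb{F}^n$ (listed in this order) by $$\mathbf{b}_r=\mathbf{b}_j^{(i)}=\mathbf{a}_i^{\beta_j^{(i)}}=\mathcal{D}_{\mathbf{a}_i}(\beta_j^{(i)})(\beta_j^{(i)})^{-1},\qquad r=M_1+\cdots+M_{i-1}+j,$$ for $j=1,\dots,M_i$ and $i=1,\dots,\ell$. Then, for any finite set of monomials $\mathcal{N}\subseteq\mathcal{M}$, it holds that $$V^{\mathcal{D}}_{\mathcal{N}}(\mathbf{a},\mathcal{B}^{\mathcal{D}})=V_{\mathcal{N}}(\mathcal{B})\cdot\mathrm{diag}\left(\beta_1^{(1)},\beta_2^{(1)},\dots,\beta_{M_\ell}^{(\ell)}\right),$$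 using the same ordering of $\mathcal{N}$ to order the rows in $V_{\mathcal{N}}(\mathcal{B})$ and $V^{\mathcal{D}}_{\mathcal{N}}(\mathbf{a},\mathcal{B}^{\mathcal{D}})$.
   Context: Rings are associative with identity, not necessarily commutative, and ring morphisms preserve identities. $\mathbb{F}^*=\mathbb{F}\setminus\{0\}$ and $\mathbb{F}^n$ denotes column vectors. A map $\delta:\mathbb{F}\to\mathbb{F}^n$ is a $\sigma$-derivation if $\delta(a+b)=\delta(a)+\delta(b)$ and $\delta(ab)=\sigma(a)\delta(b)+\delta(a)b$ for all $a,b\in\mathbb{F}$. Free skew polynomial ring: let $\mathcal{M}$ be the free monoid on pairwise distinct variables $x_1,\dots,x_n$ (monomials). $\mathbb{F}[\mathbf{x};\sigma,\delta]$ is the left $\mathbb{F}$-vector space with basis $\mathcal{M}$, with the ring product given by concatenating monomials and $x_i a=\sum_{j=1}^n\sigma_{i,j}(a)x_j+\delta_i(a)$ for $a\in\mathbb{F}$. Skew evaluation: for $\mathbf{b}=(b_1,\dots,b_n)\in\mathbb{F}^n$, $F(\mathbf{b})$ is the unique element of $\mathbb{F}$ such that $F-F(\mathbf{b})$ belongs to the left ideal generated by $x_1-b_1,\dots,x_n-b_n$. For $\mathfrak{m}\in\mathcal{M}$, $N_{\mathfrak{m}}(\mathbf{b})\in\mathbb{F}$ denotes the skew evaluation of $\mathfrak{m}$ at $\mathbf{b}$. Linearized maps: $\mathcal{D}_{\mathbf{a}}(\beta)=\sigma(\beta)\mathbf{a}+\delta(\beta)\in\mathbb{F}^n$ for $\mathbf{a}\in\mathbb{F}^n$,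 $\beta\in\mathbb{F}$. Maps $\mathcal{D}_{\mathbf{a}}^{\mathfrak{m}}:\mathbb{F}\to\mathbb{F}$ are defined recursively by $\mathcal{D}_{\mathbf{a}}^{1}=\mathrm{Id}$ and $\mathcal{D}_{\mathbf{a}}^{x_i\mathfrak{m}}(\beta)=$ the $i$-th component of $\mathcal{D}_{\mathbf{a}}(\mathcal{D}_{\mathbf{a}}^{\mathfrak{m}}(\beta))$. For $\beta\in\mathbb{F}^*$, $\mathbf{a}^\beta=\mathcal{D}_{\mathbf{a}}(\beta)\beta^{-1}$. Vandermonde matrices: for a finite ordered set $\mathcal{N}\subseteq\mathcal{M}$, the skew Vandermonde matrix $V_{\mathcal{N}}(\mathcal{B})$ is the $|\mathcal{N}|\times M$ matrix with rows $(N_{\mathfrak{m}}(\mathbf{b}_1),\dots,N_{\mathfrak{m}}(\mathbf{b}_M))$, $\mathfrak{m}\in\mathcal{N}$. The linearized Vandermonde matrix $V^{\mathcal{D}}_{\mathcal{N}}(\mathbf{a},\mathcal{B}^{\mathcal{D}})$ is the $|\mathcal{N}|\times M$ matrix with rows $$\left(\mathcal{D}^{\mathfrak{m}}_{\mathbf{a}_1}(\beta_1^{(1)}),\dots,\mathcal{D}^{\mathfrak{m}}_{\mathbf{a}_1}(\beta_{M_1}^{(1)}),\dots,\mathcal{D}^{\mathfrak{m}}_{\mathbf{a}_\ell}(\beta_1^{(\ell)}),\dots,\mathcal{D}^{\mathfrak{m}}_{\mathbf{a}_\ell}(\beta_{M_\ell}^{(\ell)})\right),\quad\mathfrak{m}\in\mathcal{N}.$$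 *)

(* Defs.v *)
From HB Require Import structures.
From mathcomp Require Import all_boot all_order all_algebra finmap.
From mathcomp Require Import monalg.
From Stdlib Require Import ClassicalEpsilon.

Set Implicit Arguments.
Unset Strict Implicit.
Unset Printing Implicit Defensive.

Import GRing.Theory.
Local Open Scope fset_scope.
Local Open Scope ring_scope.

(* Scalars need not commute: [v *c c] is the right action of c on the column
   v, whereas the library's [c *: v] is the left one. *)
Definition rscale (F : nzRingType) n (v : 'cV[F]_n) (c : F) : 'cV[F]_n :=
  \col_i (v i 0 * c).
Notation "v *c c" := (rscale v c) (at level 40, left associativity) : ring_scope.

Record sderivation (F : nzRingType) n (sigma : {rmorphism F -> 'M[F]_n}) :=
  SDerivation {
    sder :> F -> 'cV[F]_n;
    sderD : forall a b, sder (a + b) = sder a + sder b;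
    sderM : forall a b, sder (a * b) = sigma a *m sder b + sder a *c b }.

Lemma sder1 (F : nzRingType) n (sigma : {rmorphism F -> 'M[F]_n})
  (delta : sderivation sigma) : delta 1 = 0.
Proof.
have := sderM delta 1 1; rewrite mulr1 rmorph1.
have -> : delta 1 *c 1 = delta 1 by apply/colP=> k; rewrite mxE mulr1.
have -> : (1 : 'M[F]_n) *m delta 1 = delta 1 by exact: mul1mx.
by rewrite -[LHS]addr0 => /addrI/esym.
Qed.

(* The free monoid on x_0, ..., x_(n-1): [:: i; j] is x_i x_j, the product is
   [++] and the unit is [::]. *)
Notation monom n := (seq 'I_n).

Section FreeExt.
Context (K : choiceType) (F : nzRingType) (V : zmodType).
Variable phi : K -> F -> V.

(* For phi additive in F, the additive map sending c k to phi k c. *)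
Definition mext (g : {malg F[K]}) : V := \sum_(k <- msupp g) phi k g@_k.

Hypothesis phiD : forall k, {morph phi k : a b / a + b}.

Lemma phi0 k : phi k 0 = 0.
Proof. by apply: (addrI (phi k 0)); rewrite -phiD !addr0. Qed.

Lemma mextEw (d : {fset K}) g :
  msupp g `<=` d -> mext g = \sum_(k <- d) phi k g@_k.
Proof.
move=> le; rewrite /mext (big_fset_incl _ le) // => k _ kg.
by rewrite (mcoeff_outdom kg) phi0.
Qed.

Lemma mextD : {morph mext : g h / g + h}.
Proof.
move=> g h; pose d := msupp g `|` msupp h.
rewrite (mextEw (d := d)) ?msuppD_le // (mextEw (d := d)) ?fsubsetUl //.
rewrite [mext h](mextEw (d := d)) ?fsubsetUr // -big_split /=.
by apply: eq_bigr => k _; rewrite mcoeffD phiD.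
Qed.

Lemma mext0 : mext 0 = 0.
Proof. by apply: (addrI (mext 0)); rewrite -mextD !addr0. Qed.

Lemma mextU c k : mext << c *g k >> = phi k c.
Proof.
by rewrite (mextEw (d := [fset k])) ?msuppU_le // big_seq_fset1 mcoeffUU.
Qed.

End FreeExt.

Lemma malg_ind (K : choiceType) (F : nzRingType) (P : {malg F[K]} -> Prop) :
  P 0 -> (forall p q, P p -> P q -> P (p + q)) ->
  (forall c k, P << c *g k >>) -> forall p, P p.
Proof. by move=> P0 PD PU p; rewrite (monalgE p); elim/big_ind: _. Qed.

Lemma malgZU (K : choiceType) (F : nzRingType) (c d : F) (k : K) :
  c *: (<< d *g k >> : {malg F[K]}) = << c * d *g k >>.
Proof. by apply/malgP => l; rewrite mcoeffZ !mcoeffU mulrnAr. Qed.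

(* The free skew polynomial ring F[x; sigma, delta]: the left F-module with
   basis the words. The parameter delta (hence sigma) only serves to select the
   ring structure. *)
Definition skewpoly (F : nzRingType) n (sigma : {rmorphism F -> 'M[F]_n})
  (delta : sderivation sigma) : Type := {malg F[monom n]}.
HB.instance Definition _ (F : nzRingType) n
  (sigma : {rmorphism F -> 'M[F]_n}) (delta : sderivation sigma) :=
  GRing.Lmodule.on (skewpoly delta).

Section SkewPolyOps.
Context (F : nzRingType) (n : nat).
Context (sigma : {rmorphism F -> 'M[F]_n}) (delta : sderivation sigma).

Implicit Types p q r : {malg F[monom n]}.

(* x_i (c m) = (\sum_j sigma_ij(c) x_j + delta_i(c)) m *)
Definition mulxU (i : 'I_n) (m : monom n) (c : F) : {malg F[monom n]} :=
  \sum_j << sigma c i j *g j :: m >> + << delta c i 0 *g m >>.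
Definition mulx i p := mext (mulxU i) p.
Definition mulmon (m : monom n) p := foldr mulx p m.
Definition skew_mul p q := mext (fun m c => c *: mulmon m q) p.
Definition skew_one : {malg F[monom n]} := << 1 *g [::] >>.

Lemma mulxUD i m : {morph mulxU i m : a b / a + b}.
Proof.
move=> a b; rewrite /mulxU rmorphD sderD !mxE monalgUD addrACA -big_split /=.
by congr (_ + _); apply: eq_bigr => j _; rewrite mxE monalgUD.
Qed.

Lemma mulxD i : {morph mulx i : p q / p + q}.
Proof. exact: mextD (mulxUD i). Qed.
Lemma mulx0 i : mulx i 0 = 0.
Proof. exact: mext0 (mulxUD i). Qed.
Lemma mulxUE i c m : mulx i << c *g m >> = mulxU i m c.
Proof. exact: mextU (mulxUD i) _ _. Qed.

Lemma mulmonD m : {morph mulmon m : p q / p + q}.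
Proof. by move=> p q; elim: m => //= i m ->; rewrite mulxD. Qed.
Lemma mulmon0 m : mulmon m 0 = 0.
Proof. by elim: m => //= i m ->; rewrite mulx0. Qed.

Lemma mulxZ i c p :
  mulx i (c *: p) = \sum_j sigma c i j *: mulx j p + delta c i 0 *: p.
Proof.
elim/malg_ind: p => [|p q IHp IHq|d m].
- rewrite !scaler0 mulx0 addr0 big1 // => j _.
  by rewrite mulx0 scaler0.
- rewrite (scalerDr c p q) mulxD IHp IHq (scalerDr _ p q).
  under [in RHS]eq_bigr => j _ do rewrite mulxD (scalerDr _ (mulx j p)).
  by rewrite big_split; apply: addrACA.
rewrite (malgZU c d m) mulxUE /mulxU rmorphM sderM malgZU.
under [X in _ = X + _]eq_bigr => l _ do
  rewrite mulxUE /mulxU scalerDr scaler_sumr malgZU.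
rewrite big_split /= exchange_big /= -addrA; congr (_ + _).
  apply: eq_bigr => j _; rewrite mxE.
  under [RHS]eq_bigr => l _ do rewrite malgZU.
  by rewrite (raddf_sum (mkmalgU (j :: m))).
by rewrite !mxE monalgUD (raddf_sum (mkmalgU m)).
Qed.

Lemma mulmonU m m' : mulmon m << 1 *g m' >> = << 1 *g m ++ m' >>.
Proof.
elim: m => //= i m ->; rewrite mulxUE /mulxU sder1 rmorph1 mxE monalgU0 addr0.
rewrite (bigD1 i) //= big1 => [|j ji]; rewrite ?addr0.
  by rewrite [(1 : 'M[F]_n) _ _]mxE eqxx.
by rewrite [(1 : 'M[F]_n) _ _]mxE eq_sym (negPf ji) monalgU0.
Qed.

Lemma skew_mul_phiD q m : {morph (fun c => c *: mulmon m q) : a b / a + b}.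
Proof. by move=> a b; rewrite scalerDl. Qed.

Lemma skew_mulDl : left_distributive skew_mul +%R.
Proof. by move=> p q r; exact: mextD (skew_mul_phiD r) _ _. Qed.
Lemma skew_mul0l q : skew_mul 0 q = 0.
Proof. exact: mext0 (skew_mul_phiD q). Qed.
Lemma skew_mulUl c m q : skew_mul << c *g m >> q = c *: mulmon m q.
Proof. exact: mextU (skew_mul_phiD q) _ _. Qed.

Lemma skew_mulDr : right_distributive skew_mul +%R.
Proof.
move=> p q r; rewrite /skew_mul /mext -big_split /=.
by apply: eq_bigr => m _; rewrite mulmonD scalerDr.
Qed.

Lemma skew_mulZl c p q : skew_mul (c *: p) q = c *: skew_mul p q.
Proof.
elim/malg_ind: p => [|p r IHp IHr|d m].
- by rewrite scaler0 !skew_mul0l scaler0.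
- by rewrite scalerDr !skew_mulDl IHp IHr scalerDr.
by rewrite malgZU !skew_mulUl scalerA.
Qed.

Lemma skew_mulxl i p q : skew_mul (mulx i p) q = mulx i (skew_mul p q).
Proof.
elim/malg_ind: p => [|p r IHp IHr|d m].
- by rewrite mulx0 !skew_mul0l mulx0.
- by rewrite mulxD !skew_mulDl IHp IHr mulxD.
rewrite mulxUE skew_mulUl mulxZ skew_mulDl skew_mulUl; congr (_ + _).
elim/big_rec2: _ => [|j y1 y2 _ IH]; first exact: skew_mul0l.
by rewrite skew_mulDl IH skew_mulUl.
Qed.

Lemma skew_mulA : associative skew_mul.
Proof.
move=> p q r; elim/malg_ind: p => [|p s IHp IHs|c m].
- by rewrite !skew_mul0l.
- by rewrite !skew_mulDl IHp IHs.
rewrite !skew_mulUl skew_mulZl; congr (_ *: _).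
by elim: m => //= i m ->; rewrite skew_mulxl.
Qed.

Lemma skew_mul1l : left_id skew_one skew_mul.
Proof. by move=> p; rewrite /skew_one skew_mulUl scale1r. Qed.

Lemma skew_mul1r : right_id skew_one skew_mul.
Proof.
move=> p; elim/malg_ind: p => [|p s IHp IHs|c m].
- by rewrite !skew_mul0l.
- by rewrite !skew_mulDl IHp IHs.
by rewrite skew_mulUl mulmonU cats0 malgZU mulr1.
Qed.

Lemma skew_one_neq0 : skew_one != 0.
Proof. by rewrite monalgU_eq0 oner_eq0. Qed.

HB.instance Definition _ := GRing.Zmodule_isNzRing.Build (skewpoly delta)
  skew_mulA skew_mul1l skew_mul1r skew_mulDl skew_mulDr skew_one_neq0.

Definition skmon (m : monom n) : skewpoly delta := << 1 *g m >>.
Definition skC (c : F) : skewpoly delta := << c *g [::] >>.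
Definition skX (i : 'I_n) : skewpoly delta := skmon [:: i].

End SkewPolyOps.

Section SkewPolyTheory.
Context (F : nzRingType) (n : nat).
Context (sigma : {rmorphism F -> 'M[F]_n}) (delta : sderivation sigma).
Local Notation R := (skewpoly delta).
Local Notation skC := (skC delta).
Local Notation skX := (skX delta).
Local Notation skmon := (skmon delta).

(* [skmonM], [skCM] and [skX_C] are the rules that determine the product. *)
Lemma skmonM m m' : skmon m * skmon m' = skmon (m ++ m').
Proof. by rewrite [LHS]skew_mulUl scale1r mulmonU. Qed.

Lemma skCM c (p : R) : skC c * p = c *: p.
Proof. exact: skew_mulUl. Qed.

Lemma skXM i (p : R) : skX i * p = mulx delta i p.
Proof. by rewrite [LHS]skew_mulUl scale1r. Qed.

Lemma skC_is_additive : zmod_morphism skC.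
Proof. exact: monalgUB. Qed.
HB.instance Definition _ := GRing.isZmodMorphism.Build F R skC skC_is_additive.

Lemma skC_is_monoid : monoid_morphism skC.
Proof. by split=> // a b; rewrite skCM; symmetry; apply: malgZU. Qed.
HB.instance Definition _ := GRing.isMonoidMorphism.Build F R skC skC_is_monoid.

Lemma skX_C i a :
  skX i * skC a = \sum_j skC (sigma a i j) * skX j + skC (delta a i 0).
Proof.
rewrite skXM [LHS]mulxUE; congr (_ + _); apply: eq_bigr => j _.
by rewrite skCM; symmetry; rewrite [LHS]malgZU mulr1.
Qed.

End SkewPolyTheory.

Definition left_ideal_gen (R : nzRingType) (I : finType) (g : I -> R) (p : R)
  : Prop := exists c : I -> R, p = \sum_i c i * g i.

Section Evaluation.
Context (F : nzRingType) (n : nat).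
Context (sigma : {rmorphism F -> 'M[F]_n}) (delta : sderivation sigma).

Definition is_skew_eval (p : skewpoly delta) (b : 'cV[F]_n) (v : F) : Prop :=
  left_ideal_gen (fun i => skX delta i - skC delta (b i 0)) (p - skC delta v).

(* Well defined by [skew_eval_unique] below. *)
Definition skew_eval (p : skewpoly delta) (b : 'cV[F]_n) : F :=
  epsilon (inhabits 0) (is_skew_eval p b).

(* N_m(b) *)
Definition Nmon (m : monom n) (b : 'cV[F]_n) : F := skew_eval (skmon delta m) b.

(* D_a, with [Dmon] its iterate D_a^m along the word m *)
Definition Dop (a : 'cV[F]_n) (beta : F) : 'cV[F]_n :=
  sigma beta *m a + delta beta.

Fixpoint Dmon (a : 'cV[F]_n) (m : monom n) (beta : F) : F :=
  if m is i :: m' then Dop a (Dmon a m' beta) i 0 else beta.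

Section WellDefined.
Variable b : 'cV[F]_n.
Local Notation R := (skewpoly delta).
Local Notation skC := (skC delta).
Local Notation skX := (skX delta).
Local Notation skmon := (skmon delta).
Local Notation ideal := (left_ideal_gen (fun i => skX i - skC (b i 0))).

Lemma idealD p q : ideal p -> ideal q -> ideal (p + q).
Proof.
move=> [c ->] [d ->]; exists (fun i => c i + d i).
by rewrite -big_split /=; apply: eq_bigr => i _; rewrite mulrDl.
Qed.

Lemma ideal0 : ideal 0.
Proof. by exists (fun=> 0); rewrite big1 // => i _; rewrite mul0r. Qed.

Lemma idealMl p q : ideal q -> ideal (p * q).
Proof.
move=> [c ->]; exists (fun i => p * c i).
by rewrite mulr_sumr; apply: eq_bigr => i _; rewrite mulrA.
Qed.

Lemma ideal_gen i : ideal (skX i - skC (b i 0)).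
Proof.
exists (fun j => if j == i then 1 else 0); rewrite (bigD1 i) //= eqxx mul1r.
by rewrite big1 ?addr0 // => j /negPf ->; rewrite mul0r.
Qed.

Lemma skew_eval_ex (p : R) : exists v, is_skew_eval p b v.
Proof.
rewrite /is_skew_eval; move: p.
apply: (@malg_ind _ F (fun p : R => exists v, ideal (p - skC v))).
- by exists 0; rewrite rmorph0 subr0; apply: ideal0.
- move=> p q [v hv] [w hw]; exists (v + w); rewrite rmorphD opprD addrACA.
  exact: idealD.
move=> c m; have [v hv] : exists v, ideal (skmon m - skC v).
  elim: m => [|i m [v hv]].
    by exists 1; rewrite rmorph1 subrr; apply: ideal0.
  exists (Dop b v i 0).
  have -> : skmon (i :: m) = skX i * skmon m by rewrite skmonM.
  have := idealMl (skX i) hv; rewrite mulrBr skX_C => h.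
  have h2 : ideal (\sum_j skC (sigma v i j) * (skX j - skC (b j 0))).
    by exists (fun j => skC (sigma v i j)).
  suff <- : skX i * skmon m - (\sum_j skC (sigma v i j) * skX j
              + skC (delta v i 0))
     + \sum_j skC (sigma v i j) * (skX j - skC (b j 0))
     = skX i * skmon m - skC (Dop b v i 0) by exact: idealD.
  have -> : skC (Dop b v i 0)
      = \sum_j skC (sigma v i j * b j 0) + skC (delta v i 0).
    by rewrite /Dop !mxE rmorphD rmorph_sum.
  under [X in _ + X = _]eq_bigr => j _ do rewrite mulrBr -rmorphM.
  rewrite sumrB -!addrA; congr (_ + _).
  by rewrite opprD addrACA addNr add0r -opprD addrC.
exists (c * v); have := idealMl (skC c) hv.
by rewrite mulrBr -rmorphM skCM (malgZU c 1 m) mulr1.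
Qed.

Let ev (p : R) : F := mext (fun m c => c * Dmon b m 1) p.

Lemma ev_phiD m : {morph (fun c => c * Dmon b m 1) : x y / x + y}.
Proof. by move=> x y; rewrite mulrDl. Qed.
Lemma evD : {morph ev : p q / p + q}. Proof. exact: mextD ev_phiD. Qed.
Lemma ev0 : ev 0 = 0. Proof. exact: mext0 ev_phiD. Qed.
Lemma evU c m : ev << c *g m >> = c * Dmon b m 1.
Proof. exact: mextU ev_phiD _ _. Qed.
Lemma evC c : ev (skC c) = c. Proof. by rewrite evU mulr1. Qed.
Lemma evN p : ev (- p) = - ev p.
Proof. by apply: (addrI (ev p)); rewrite -evD !subrr ev0. Qed.
Lemma ev_sum (I : finType) (f : I -> R) : ev (\sum_i f i) = \sum_i ev (f i).
Proof. by apply: (big_morph _ evD ev0). Qed.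
Lemma evZ c p : ev (c *: p) = c * ev p.
Proof.
move: p; apply: malg_ind => [|p q IHp IHq|d m].
- by rewrite scaler0 ev0 mulr0.
- by rewrite scalerDr !evD IHp IHq mulrDr.
by rewrite malgZU !evU mulrA.
Qed.

Lemma DopD a : {morph Dop a : x y / x + y}.
Proof. by move=> x y; rewrite /Dop rmorphD sderD mulmxDl addrACA. Qed.

Lemma ev_mulx i (p : R) : ev (mulx delta i p) = Dop b (ev p) i 0.
Proof.
have D0 : Dop b 0 = 0 by apply: (addrI (Dop b 0)); rewrite -DopD !addr0.
move: p; apply: malg_ind => [|p q IHp IHq|d m].
- by rewrite mulx0 ev0 D0 mxE.
- by rewrite mulxD !evD IHp IHq DopD [RHS]mxE.
rewrite mulxUE /mulxU evD ev_sum !evU /Dop rmorphM sderM.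
rewrite -mulmxA addrA -mulmxDr.
under eq_bigr => j _ do rewrite evU /= -/(Dop b (Dmon b m 1)).
by rewrite [RHS]mxE; congr (_ + _); rewrite mxE.
Qed.

Lemma ev_ideal p : ideal p -> ev p = 0.
Proof.
move=> [c ->]; rewrite ev_sum big1 // => i _.
move: (c i); apply: malg_ind => [|p1 p2 IH1 IH2|d m].
- by rewrite mul0r ev0.
- by rewrite mulrDl evD IH1 IH2 addr0.
rewrite [_ * _]skew_mulUl evZ; suff -> : ev (mulmon delta m (skX i - skC (b i 0))) = 0
  by rewrite mulr0.
have D0 : Dop b 0 = 0 by apply: (addrI (Dop b 0)); rewrite -DopD !addr0.
elim: m => [|j m IH] /=; last by rewrite ev_mulx IH D0 mxE.
have -> : skX i = mulx delta i (1 : R) by rewrite -skXM mulr1.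
rewrite evD evN evC ev_mulx evU mulr1 /Dop rmorph1 sder1.
by rewrite addr0 [_ *m b]mul1mx subrr.
Qed.

Lemma skew_eval_unique (p : R) : exists! v, is_skew_eval p b v.
Proof.
have [v hv] := skew_eval_ex p; exists v; split=> // w hw.
have evE u : is_skew_eval p b u -> ev p = u.
  by move/ev_ideal; rewrite evD evN evC => /eqP; rewrite subr_eq0 => /eqP.
by rewrite -(evE _ hv) -(evE _ hw).
Qed.

End WellDefined.
End Evaluation.

Section Vandermonde.
Context (F : unitRingType) (n : nat).
Context (sigma : {rmorphism F -> 'M[F]_n}) (delta : sderivation sigma).

(* a^beta *)
Definition skew_conj (a : 'cV[F]_n) (beta : F) : 'cV[F]_n :=
  Dop delta a beta *c beta^-1.

(* The ordered set of monomials is a duplicate-free sequence, its order being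
   that of the rows. *)
Definition skew_vandermonde (N : seq (monom n)) k (b : 'I_k -> 'cV[F]_n) :
    'M[F]_(size N, k) :=
  \matrix_(r, s) Nmon delta (tnth (in_tuple N) r) (b s).

(* Column tagnat.Rank i j of a block row indexed by 'I_(\sum_i M i) is column j
   of block i; its value is (\sum_(k < l | k < i) M k) + j (tagnat.RankEsum). *)
Definition lin_vandermonde (N : seq (monom n)) l (a : 'I_l -> 'cV[F]_n)
    (M : 'I_l -> nat) (beta : forall i, 'I_(M i) -> F) :
    'M[F]_(size N, \sum_i M i) :=
  \mxrow_i \matrix_(r, j) Dmon delta (a i) (tnth (in_tuple N) r) (beta i j).

End Vandermonde.

(* Main.v *)
(* The product rule for delta gives D_a(x beta) = D_{a^beta}(x) beta, so that by
   induction on the monomial D_a^m(beta) = D_{a^beta}^m(1) beta, while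
   D_b^m(1) = N_m(b). *)
Require Import Defs.
From HB Require Import structures.
From mathcomp Require Import all_boot all_order all_algebra.
From Stdlib Require Import ClassicalEpsilon.

Set Implicit Arguments.
Unset Strict Implicit.
Unset Printing Implicit Defensive.

Import GRing.Theory.
Local Open Scope ring_scope.

(** Entry by entry the claim is D_a^m(beta) = N_m(a^beta) beta, since the diagonal factor scales
    each column on the right. [Dmon_skew_conj] proves it with D_b^m(1) in place of N_m(b), and
    [NmonE] identifies the two. *)

(* The left F-linear map m |-> D_b^m(1) fixes the constants and vanishes on the
   left ideal of the x_i - b_i, hence it is the evaluation at b. *)
Lemma NmonE (F : nzRingType) n (sigma : {rmorphism F -> 'M[F]_n})
    (delta : sderivation sigma) (m : monom n) (b : 'cV[F]_n) :
  Nmon delta m b = Dmon delta b m 1.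
Proof.
have : is_skew_eval (skmon delta m) b (Nmon delta m b).
  exact: epsilon_spec (skew_eval_ex b (skmon delta m)).
move=> /ev_ideal/eqP; rewrite evD evN evC evU mul1r subr_eq0.
by move=> /eqP.
Qed.

(** Expanding delta(x beta) gives sigma(x) D_a(beta) + delta(x) beta, and D_a(beta) = a^beta beta
    because beta is invertible; beta then factors out on the right. *)
Lemma Dop_skew_conj (F : unitRingType) n (sigma : {rmorphism F -> 'M[F]_n})
    (delta : sderivation sigma) (a : 'cV[F]_n) (beta x : F) :
  beta \is a GRing.unit ->
  Dop delta a (x * beta) = Dop delta (skew_conj delta a beta) x *c beta.
Proof.
move=> Ubeta; have rscaleMl (A : 'M[F]_n) v c : (A *m v) *c c = A *m (v *c c).
  apply/colP => i; rewrite !mxE mulr_suml.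
  by apply: eq_bigr => k _; rewrite !mxE mulrA.
have rscaleDl (u v : 'cV[F]_n) c : (u + v) *c c = u *c c + v *c c.
  by apply/colP => i; rewrite !mxE mulrDl.
have conjK : skew_conj delta a beta *c beta = Dop delta a beta.
  by apply/colP => i; rewrite !mxE mulrVK.
rewrite [RHS]rscaleDl rscaleMl conjK /Dop rmorphM sderM -mulmxA addrA.
by rewrite -mulmxDr.
Qed.

Lemma Dmon_skew_conj (F : unitRingType) n (sigma : {rmorphism F -> 'M[F]_n})
    (delta : sderivation sigma) (a : 'cV[F]_n) (beta : F) (m : monom n) :
  beta \is a GRing.unit ->
  Dmon delta a m beta = Dmon delta (skew_conj delta a beta) m 1 * beta.
Proof.
move=> Ubeta; elim: m => [|i m IHm] /=; first by rewrite mul1r.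
by rewrite IHm Dop_skew_conj // mxE.
Qed.

Theorem theorem9 (F : unitRingType)
  (F_div : forall x : F, x != 0 -> x \is a GRing.unit)
  (n : nat) (n_gt0 : (0 < n)%N)
  (sigma : {rmorphism F -> 'M[F]_n}) (delta : sderivation sigma)
  (l : nat) (a : 'I_l -> 'cV[F]_n)
  (M : 'I_l -> nat) (beta : forall i : 'I_l, 'I_(M i) -> F)
  (beta_neq0 : forall (i : 'I_l) (j : 'I_(M i)), beta i j != 0)
  (b : 'I_(\sum_i M i)%N -> 'cV[F]_n)
  (bE : forall (i : 'I_l) (j : 'I_(M i)),
      b (tagnat.Rank i j) = skew_conj delta (a i) (beta i j))
  (N : seq (monom n)) (N_uniq : uniq N) :
  lin_vandermonde delta N a beta
  = skew_vandermonde delta N b *m diag_mx (\mxrow_i \row_j beta i j).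
Proof.
apply/matrixP => r s; rewrite mul_mx_diag !mxE NmonE.
(* The column index is rewritten as the rank of its block and its position there, the form in which
   [bE] describes [b]. *)
by rewrite -[s in b s]tagnat.sigK tagnat.rankE bE -Dmon_skew_conj // F_div.
Qed.
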